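(* Let $(X,d)$ be the gluing of a family of hyperconvex metric spaces $(X_\lambda,d_\lambda)_{\lambda\in\Lambda}$ along a set $A$ such that (the copy of) $A$ is externally hyperconvex in each $X_\lambda$. Then $X$ is hyperconvex, and moreover $A$ is externally hyperconvex in $X$.
   Context: A metric space is hyperconvex if every collection of closed balls $\{B(x_i,r_i)\}$ with $d(x_i,x_j)\le r_i+r_j$ for all $i,j$ has non-empty intersection. A subset $A\subset X$ is externally hyperconvex in $X$ if for every collection of closed balls $\{B(x_i,r_i)\}_{i\in I}$ in $X$ with $d(x_i,x_j)\le r_i+r_j$ and $d(x_i,A)\le r_i$ for all $i,j$, one has $A\cap\bigcap_i B(x_i,r_i)\ne\emptyset$. Gluing: let $(X_\lambda,d_\lambda)_{\lambda\in\Lambda}$ be metric spaces, $A$ a metric space, and for each $\lambda$ let $\varphi_\lambda\colon A\to X_\lambda$ be an isometric embedding with closed image $A_\lambda$. The gluing $X$ is the quotient of $\bigsqcup_\lambda X_\lambda$ by the equivalence relation generated by $\varphi_\lambda(a)\sim\varphi_{\lambda'}(a)$, $a\in A$, with metric $d(x,y)=d_\lambda(x,y)$ if $x,y\in X_\lambda$, and $d(x,y)=\inf_{a\in A}\{d_\lambda(x,\varphi_\lambda(a))+d_{\lambda'}(\varphi_{\lambda'}(a),y)\}$ if $x\in X_\lambda$, $y\in X_{\lambda'}$, $\lambda\ne\lambda'$. The sets $A_\lambda$ are identified with $A$. *)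

(* Defs.v *)
From Stdlib Require Import Reals Classical ClassicalEpsilon.
Open Scope R_scope.
Set Implicit Arguments.
Unset Strict Implicit.

Definition is_metric (T : Type) (d : T -> T -> R) : Prop :=
  (forall x y, 0 <= d x y) /\
  (forall x y, d x y = 0 <-> x = y) /\
  (forall x y, d x y = d y x) /\
  (forall x y z, d x z <= d x y + d y z).

Definition is_glb (S : R -> Prop) (m : R) : Prop :=
  (forall s, S s -> m <= s) /\ (forall m', (forall s, S s -> m' <= s) -> m' <= m).

Definition Rinf (S : R -> Prop) : R := epsilon (inhabits 0) (is_glb S).

Definition dist_set (T : Type) (d : T -> T -> R) (S : T -> Prop) (x : T) : R :=
  Rinf (fun s => exists y, S y /\ s = d x y).

Definition ball (T : Type) (d : T -> T -> R) (c : T) (r : R) (y : T) : Prop :=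
  d c y <= r.

Definition hyperconvex (T : Type) (d : T -> T -> R) : Prop :=
  forall (I : Type) (x : I -> T) (r : I -> R),
    (forall i j, d (x i) (x j) <= r i + r j) ->
    exists z, forall i, ball d (x i) (r i) z.

Definition ext_hyperconvex (T : Type) (d : T -> T -> R) (S : T -> Prop) : Prop :=
  forall (I : Type) (x : I -> T) (r : I -> R),
    (forall i j, d (x i) (x j) <= r i + r j) ->
    (forall i, dist_set d S (x i) <= r i) ->
    exists z, S z /\ forall i, ball d (x i) (r i) z.

Definition is_closed (T : Type) (d : T -> T -> R) (S : T -> Prop) : Prop :=
  forall x, (forall eps, 0 < eps -> exists y, S y /\ d x y < eps) -> S x.

Definition image (A T : Type) (phi : A -> T) (x : T) : Prop := exists a, x = phi a.

(* The gluing metric, defined on the disjoint union {l : L & X l}.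
   Points identified by the gluing are exactly those at distance 0. *)
Definition glue_dist (L : Type) (X : L -> Type) (d : forall l, X l -> X l -> R)
  (A : Type) (phi : forall l, A -> X l)
  (p q : {l : L & X l}) : R :=
  match excluded_middle_informative (projT1 p = projT1 q) with
  | left e => d (projT1 q) (eq_rect (projT1 p) X (projT2 p) (projT1 q) e) (projT2 q)
  | right _ => Rinf (fun s => exists a : A,
      s = d (projT1 p) (projT2 p) (phi (projT1 p) a)
          + d (projT1 q) (phi (projT1 q) a) (projT2 q))
  end.

Definition glued_A (L : Type) (X : L -> Type) (A : Type) (phi : forall l, A -> X l)
  (p : {l : L & X l}) : Prop :=
  exists a : A, p = existT X (projT1 p) (phi (projT1 p) a).

(* Main.v *)
(* Each ball B(x_i, r_i) traces an externally hyperconvex subset E_i on A. If x_i and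
   x_j lie in different pieces, d(x_i, x_j) <= r_i + r_j only says that E_i and E_j are
   at distance 0, and A is externally hyperconvex in the gluing once the E_i are shown
   to have a common point. For two externally hyperconvex sets at distance 0 one
   bounces between them towards a prescribed point. For arbitrary families one takes,
   in the manner of Baillon, a minimal f : A -> R with d(a, b) <= f a + f b and
   d(a, E_i) <= f a: the balls B(a, f a) have a common point in each intersection
   of two E_i, and minimality forces these balls to meet in a single point. *)

Require Import Defs.
From Stdlib Require Import Reals Lra Lia Classical ClassicalEpsilon.
From mathcomp.classical Require boolp classical_sets.
Open Scope R_scope.
Set Implicit Arguments.
Unset Strict Implicit.

(** * Infima of reals and distances to a set *)

Lemma Rinf_is_glb (S : R -> Prop) (m : R) :
  (exists s, S s) -> (forall s, S s -> m <= s) -> is_glb S (Rinf S).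
Proof.
intros [s Ss] Hm; unfold Rinf; apply epsilon_spec.
destruct (completeness (fun t => S (- t))) as [u [Hub Hlub]].
- exists (- m); intros t Ht; specialize (Hm _ Ht); lra.
- exists (- s); rewrite Ropp_involutive; exact Ss.
- exists (- u); split.
  + intros t St; assert (- t <= u); [| lra].
    apply Hub; rewrite Ropp_involutive; exact St.
  + intros m' Hm'; assert (u <= - m'); [| lra].
    apply Hlub; intros t Ht; specialize (Hm' _ Ht); lra.
Qed.

Lemma Rinf_approx (S : R -> Prop) (m r : R) :
  (exists s, S s) -> (forall s, S s -> m <= s) -> Rinf S < r ->
  exists s, S s /\ s < r.
Proof.
intros HS Hm Hr; destruct (Rinf_is_glb HS Hm) as [_ H].
apply NNPP; intros Hn; assert (r <= Rinf S); [| lra].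
apply H; intros s Ss; destruct (Rlt_le_dec s r); [| assumption].
exfalso; apply Hn; exists s; auto.
Qed.

(** Infima need not be attained; the slack [eta] lets later arguments work with actual points of [S]
    instead of [Rinf]. *)
Lemma dist_set_leP (T : Type) (d : T -> T -> R) (S : T -> Prop) (x : T) (r : R) :
  (forall x y, 0 <= d x y) -> (exists y, S y) ->
  (dist_set d S x <= r <->
   forall eta, 0 < eta -> exists y, S y /\ d x y <= r + eta).
Proof.
intros d0 [y0 Sy0]; unfold dist_set; set (D := fun s => _).
assert (HD : exists s, D s) by (exists (d x y0), y0; auto).
assert (D0 : forall s, D s -> 0 <= s) by (intros s (y & _ & ->); apply d0).
split.
- intros Hr eta Heta.
  destruct (@Rinf_approx D 0 (r + eta)) as (s & (y & Sy & ->) & Hs); auto; try lra.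
  exists y; split; [exact Sy | lra].
- intros H; apply le_epsilon; intros eta Heta.
  destruct (H eta Heta) as (y & Sy & Hy).
  apply Rle_trans with (2 := Hy).
  apply (Rinf_is_glb HD D0); exists y; auto.
Qed.

Lemma dist_set_le (T : Type) (d : T -> T -> R) (S : T -> Prop) (x y : T) :
  (forall x y, 0 <= d x y) -> S y -> dist_set d S x <= d x y.
Proof.
intros d0 Sy; apply dist_set_leP; eauto.
intros eta Heta; exists y; split; [exact Sy | lra].
Qed.

Lemma dist_set_ge0 (T : Type) (d : T -> T -> R) (S : T -> Prop) (x : T) :
  (forall x y, 0 <= d x y) -> (exists y, S y) -> 0 <= dist_set d S x.
Proof.
intros d0 HS; apply le_epsilon; intros eta Heta.
destruct (proj1 (@dist_set_leP T d S x _ d0 HS) (Rle_refl _) eta Heta) as (y & _ & Hy).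
specialize (d0 x y); lra.
Qed.

Lemma le0_of_le_pow_half (C x : R) : (forall n, x <= C * (1 / 2) ^ n) -> x <= 0.
Proof.
intros H; destruct (Rle_lt_dec x 0) as [| x0]; [assumption | exfalso].
assert (C0 : 0 < C) by (specialize (H 0%nat); simpl in H; lra).
destruct (@pow_lt_1_zero (1 / 2)) with (y := x / C) as [N HN].
- rewrite Rabs_pos_eq; lra.
- apply Rdiv_lt_0_compat; assumption.
- specialize (HN N (le_n N)); specialize (H N).
  rewrite Rabs_pos_eq in HN by (apply pow_le; lra).
  apply Rmult_lt_compat_l with (r := C) in HN; [| assumption].
  replace (C * (x / C)) with x in HN by (field; lra); lra.
Qed.

(** The empty family of balls already yields a point. *)
Lemma ext_hyperconvex_nonempty (T : Type) (d : T -> T -> R) (E : T -> Prop) :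
  ext_hyperconvex d E -> exists z, E z.
Proof.
intros H; destruct (H False (fun i => match i with end) (fun _ => 0)) as (z & Ez & _);
  try (intros []); eauto.
Qed.

(** * Intersection of two externally hyperconvex sets at distance zero *)

Section Metric.

Variables (T : Type) (d : T -> T -> R).
Hypothesis Hd : is_metric d.

Let d0 x y : 0 <= d x y. Proof. apply Hd. Qed.
Let dxx x : d x x = 0. Proof. apply Hd; reflexivity. Qed.
Let dC x y : d x y = d y x. Proof. apply Hd. Qed.
Let dtri x y z : d x z <= d x y + d y z. Proof. apply Hd. Qed.

Lemma ext_hyperconvex_cons (E : T -> Prop) (I : Type) (c : I -> T) (s : I -> R)
    (p : T) (t : R) :
  ext_hyperconvex d E ->
  (forall i j, d (c i) (c j) <= s i + s j) ->
  (forall i, dist_set d E (c i) <= s i) ->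
  dist_set d E p <= t ->
  (forall i, d (c i) p <= s i + t) ->
  exists z, E z /\ (forall i, d (c i) z <= s i) /\ d p z <= t.
Proof.
intros HE Hc Hs Hp Ht.
assert (t0 : 0 <= t).
{ apply Rle_trans with (2 := Hp); apply dist_set_ge0; auto.
  exact (ext_hyperconvex_nonempty HE). }
destruct (HE (option I) (fun o => match o with Some i => c i | None => p end)
  (fun o => match o with Some i => s i | None => t end)) as (z & Ez & Hz).
- intros [i|] [j|]; auto.
  + rewrite dC, Rplus_comm; auto.
  + rewrite dxx; lra.
- intros [i|]; auto.
- exists z; split; [exact Ez |]; split; [intros i; exact (Hz (Some i)) | exact (Hz None)].
Qed.

Section Pair.

Variables E E' : T -> Prop.
Hypotheses (HE : ext_hyperconvex d E) (HE' : ext_hyperconvex d E').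
Hypothesis Hnear : forall eps, 0 < eps -> exists p q, E p /\ E' q /\ d p q <= eps.

(* Starting from an eps-close pair far from the balls, bounce between E and E':
   each bounce stays eps-close to the previous point and comes eps closer to
   every ball. *)
Lemma ext_hyperconvex_close_pair (I : Type) (c : I -> T) (s : I -> R) (eps : R) :
  0 < eps ->
  (forall i j, d (c i) (c j) <= s i + s j) ->
  (forall i, dist_set d E (c i) <= s i) ->
  (forall i, dist_set d E' (c i) <= s i) ->
  exists b b', E b /\ E' b' /\ d b b' <= eps /\ forall i, d (c i) b <= s i.
Proof.
intros Heps Hc Hs Hs'.
destruct (HE Hc Hs) as (w & Ew & Hw); unfold ball in Hw.
destruct (Hnear Heps) as (p & q & Ep & Eq & Hpq).
(* Since [w] lies in every ball, [p] and [q] exceed each radius by at most [D]. *)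
set (D := d w p + eps).
assert (step : forall n : nat, exists b b', E b /\ E' b' /\ d b b' <= eps /\
  forall i, d (c i) b <= s i + Rmax (D - INR n * eps) 0 /\
            d (c i) b' <= s i + Rmax (D - INR n * eps) 0).
{ induction n as [| n (b & b' & Eb & Eb' & Hbb' & IH)].
  - exists p, q; do 3 (split; [assumption |]); intros i.
    assert (H := Rmax_l (D - INR 0 * eps) 0); simpl in H |- *.
    assert (H1 := dtri (c i) w p); assert (H2 := dtri (c i) p q).
    specialize (Hw i); unfold D in *; split; lra.
  - set (m := Rmax (D - INR (S n) * eps) 0).
    assert (m0 : 0 <= m) by apply Rmax_r.
    assert (Hm : Rmax (D - INR n * eps) 0 <= m + eps).
    { apply Rmax_lub; [| lra].
      assert (H := Rmax_l (D - INR (S n) * eps) 0); rewrite S_INR in H at 1.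
      unfold m; lra. }
    destruct (@ext_hyperconvex_cons E I c (fun i => s i + m) b' eps) as (e & Ee & He & Heb).
    + exact HE.
    + intros i j; specialize (Hc i j); lra.
    + intros i; specialize (Hs i); lra.
    + apply Rle_trans with (2 := Hbb'); rewrite dC; apply dist_set_le; auto.
    + intros i; destruct (IH i); lra.
    + destruct (@ext_hyperconvex_cons E' I c (fun i => s i + m) e eps)
        as (e' & Ee' & He' & Hee').
      * exact HE'.
      * intros i j; specialize (Hc i j); lra.
      * intros i; specialize (Hs' i); lra.
      * apply Rle_trans with (2 := Heb); rewrite dC; apply dist_set_le; auto.
      * intros i; specialize (He i); lra.
      * exists e, e'; auto 6. }
destruct (@INR_archimed eps D Heps) as [n Hn].
destruct (step n) as (b & b' & Eb & Eb' & Hbb' & H).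
exists b, b'; do 3 (split; [assumption |]); intros i.
destruct (H i) as [H1 _]; rewrite Rmax_right in H1; lra.
Qed.

(** Close pairs yield a sequence in [E] whose steps and distances to [E'] are at most [(1 / 2) ^ n].
    In place of a limit, balls about its terms are added to the family: [E] and [E'] each provide a
    point in all of them, and the two points coincide because the radii tend to 0. *)
Lemma ext_hyperconvex_inter (I : Type) (c : I -> T) (s : I -> R) :
  (forall i j, d (c i) (c j) <= s i + s j) ->
  (forall i, dist_set d E (c i) <= s i) ->
  (forall i, dist_set d E' (c i) <= s i) ->
  exists z, E z /\ E' z /\ forall i, d (c i) z <= s i.
Proof.
intros Hc Hs Hs'.
pose (e n := (1 / 2) ^ n).
assert (epos : forall n, 0 < e n) by (intros n; apply pow_lt; lra).
assert (eS : forall n, e (S n) = e n / 2) by (intros n; unfold e; simpl; lra).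
pose (P n b := E b /\ dist_set d E' b <= e n /\ forall i, d (c i) b <= s i).
assert (next : forall n b, P n b -> exists b', P (S n) b' /\ d b b' <= e n).
{ intros n b (Eb & Eb' & Hb).
  (* The extra ball about [b] keeps the step short; radius [e n] is enough because [b] is within
     [e n] of [E']. *)
  destruct (@ext_hyperconvex_close_pair (option I)
    (fun o => match o with Some i => c i | None => b end)
    (fun o => match o with Some i => s i | None => e n end) (e (S n)))
    as (g & g' & Eg & Eg' & Hgg' & Hg).
  - apply epos.
  - assert (Hb' : forall i, d (c i) b <= s i + e n)
      by (intros i; specialize (Hb i); specialize (epos n); lra).
    intros [i|] [j|]; auto.
    + rewrite dC, Rplus_comm; auto.
    + rewrite dxx; specialize (epos n); lra.
  - intros [i|]; auto.
    apply Rle_trans with (d b b); [apply dist_set_le; auto |].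
    rewrite dxx; specialize (epos n); lra.
  - intros [i|]; auto.
  - exists g; split; [| exact (Hg None)].
    split; [exact Eg |]; split; [| intros i; exact (Hg (Some i))].
    apply Rle_trans with (2 := Hgg'); apply dist_set_le; auto. }
assert (first : exists b, P 0%nat b).
{ destruct (@ext_hyperconvex_close_pair I c s (e 0%nat)) as (g & g' & Eg & Eg' & Hgg' & Hg);
    auto.
  exists g; split; [exact Eg |]; split; [| exact Hg].
  apply Rle_trans with (2 := Hgg'); apply dist_set_le; auto. }
destruct first as [b0 Hb0].
pose (b := nat_rect (fun _ => T) b0
  (fun n x => epsilon (inhabits x) (fun y => P (S n) y /\ d x y <= e n))).
assert (Pb : forall n, P n (b n)).
{ induction n as [| n IH]; [exact Hb0 |].
  exact (proj1 (epsilon_spec (inhabits (b n)) _ (@next n (b n) IH))). }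
assert (Hb : forall n, d (b n) (b (S n)) <= e n).
{ intros n; exact (proj2 (epsilon_spec (inhabits (b n)) _ (@next n (b n) (Pb n)))). }
(* Closed form of the geometric sum; it makes the balls of radius [2 * e n] about the terms pairwise
   compatible. *)
assert (Hbk : forall n k, d (b n) (b (n + k)%nat) <= 2 * e n - 2 * e (n + k)%nat).
{ intros n; induction k as [| k IH].
  - rewrite Nat.add_0_r, dxx; lra.
  - rewrite Nat.add_succ_r, eS.
    assert (H := dtri (b n) (b (n + k)%nat) (b (S (n + k)))).
    specialize (Hb (n + k)%nat); lra. }
assert (Hbb : forall n m, d (b n) (b m) <= 2 * e n + 2 * e m).
{ intros n m; destruct (Nat.le_ge_cases n m) as [h|h].
  - replace m with (n + (m - n))%nat by lia.
    assert (H := Hbk n (m - n)%nat); specialize (epos (n + (m - n))%nat); lra.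
  - replace n with (m + (n - m))%nat by lia; rewrite dC.
    assert (H := Hbk m (n - m)%nat); specialize (epos (m + (n - m))%nat); lra. }
pose (c' (o : I + nat) := match o with inl i => c i | inr n => b n end).
pose (s' (o : I + nat) := match o with inl i => s i | inr n => 2 * e n end).
assert (Hc' : forall i j, d (c' i) (c' j) <= s' i + s' j).
{ assert (Hcb : forall i n, d (c i) (b n) <= s i + 2 * e n).
  { intros i n; destruct (Pb n) as (_ & _ & H).
    specialize (H i); specialize (epos n); lra. }
  intros [i|n] [j|m]; simpl; auto; rewrite dC, Rplus_comm; auto. }
destruct (HE Hc') as (z & Ez & Hz).
{ intros [i|n]; simpl; auto.
  apply Rle_trans with (d (b n) (b n)); [apply dist_set_le; auto; apply Pb |].
  rewrite dxx; specialize (epos n); lra. }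
destruct (HE' Hc') as (z' & Ez' & Hz').
{ intros [i|n]; simpl; auto.
  destruct (Pb n) as (_ & H & _); specialize (epos n); lra. }
unfold ball in Hz, Hz'.
assert (Hzz' : z = z').
{ apply Hd; apply Rle_antisym; [| apply d0].
  (* Both [z] and [z'] are within [2 * e n] of [b n]. *)
  apply le0_of_le_pow_half with (C := 4); intros n; change ((1 / 2) ^ n) with (e n).
  assert (H := dtri z (b n) z'); rewrite (dC z (b n)) in H.
  assert (H1 := Hz (inr n)); assert (H2 := Hz' (inr n)); simpl in H1, H2; lra. }
exists z; split; [exact Ez |]; split; [rewrite Hzz'; exact Ez' |].
intros i; exact (Hz (inl i)).
Qed.

End Pair.

(** * A Helly theorem for externally hyperconvex sets *)

Section Helly.

Variables (I : Type) (E : I -> T -> Prop) (i0 : I) (w : T) (rho : R).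
Hypothesis HE : forall i, ext_hyperconvex d (E i).
Hypothesis Hnear :
  forall i j eps, 0 < eps -> exists p q, E i p /\ E j q /\ d p q <= eps.
Hypothesis Hbounded : forall p, E i0 p -> d w p <= rho.

(** The minimal functions satisfying the first condition form the injective hull of [T]. Both
    conditions together let external hyperconvexity of each [E i] be applied to the balls B(a, f
    a). *)
Definition admissible (f : T -> R) : Prop :=
  (forall a b, d a b <= f a + f b) /\ (forall i a, dist_set d (E i) a <= f a).

Let E_nonempty i : exists z, E i z.
Proof. exact (ext_hyperconvex_nonempty (@HE i)). Qed.

Lemma admissible_ge0 (f : T -> R) (a : T) : admissible f -> 0 <= f a.
Proof. intros [H _]; specialize (H a a); rewrite dxx in H; lra. Qed.

(** All of [E i0] is within [rho] of [w], and every [E i] comes arbitrarily close to [E i0]. *)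
Lemma admissible_exists : exists f, admissible f.
Proof.
exists (fun a => d w a + rho).
assert (rho0 : 0 <= rho).
{ destruct (E_nonempty i0) as [z Ez]; specialize (@Hbounded z Ez); specialize (d0 w z); lra. }
split.
- intros a b; assert (H := dtri a w b); rewrite (dC a w) in H; lra.
- intros i a; apply dist_set_leP; auto; intros eta Heta.
  destruct (@Hnear i0 i eta Heta) as (p & q & Ep & Eq & Hpq).
  exists q; split; [exact Eq |].
  assert (H1 := dtri a p q); assert (H2 := dtri a w p); rewrite (dC a w) in H2.
  specialize (@Hbounded p Ep); lra.
Qed.

(** Zorn's lemma for the reversed pointwise order: a nonempty chain is bounded by its pointwise
    infimum. *)
Lemma admissible_minimal :
  exists f, admissible f /\
    forall g, admissible g -> (forall a, g a <= f a) -> forall a, f a <= g a.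
Proof.
destruct admissible_exists as [f0 Hf0].
pose (F := {f | admissible f}).
pose (le (f g : F) := forall a, proj1_sig g a <= proj1_sig f a).
destruct (@classical_sets.ZL_preorder F (exist _ f0 Hf0) (fun f g => boolp.asbool (le f g)))
  as [[f Hf] Hmin].
- intros f; apply boolp.asboolT; intros a; apply Rle_refl.
- intros g f h Hfg Hgh; apply boolp.asboolT; intros a.
  apply boolp.asboolW in Hfg; apply boolp.asboolW in Hgh.
  exact (Rle_trans _ _ _ (Hgh a) (Hfg a)).
- intros C Ctot.
  destruct (classic (exists f, C f)) as [[f1 Cf1] | Cempty];
    [| exists (exist _ f0 Hf0); intros s Cs; exfalso; eauto].
  pose (V a t := exists f : F, C f /\ t = proj1_sig f a).
  assert (VN : forall a, exists t, V a t) by (intros a; exists (proj1_sig f1 a), f1; auto).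
  assert (V0 : forall a t, V a t -> 0 <= t)
    by (intros a t ([f Hf] & _ & ->); apply admissible_ge0; exact Hf).
  pose (m a := Rinf (V a)).
  assert (Hm : admissible m).
  { split.
    - intros a b; apply le_epsilon; intros eta Heta.
      destruct (@Rinf_approx (V a) 0 (m a + eta / 2)) as (ta & (fa & Ca & ->) & Ha);
        [apply VN | apply V0 | unfold m; lra |].
      destruct (@Rinf_approx (V b) 0 (m b + eta / 2)) as (tb & (fb & Cb & ->) & Hb);
        [apply VN | apply V0 | unfold m; lra |].
      (* Both values must come from one function; of two comparable functions the smaller serves at
         [a] and at [b]. *)
      assert (H : exists f : F, proj1_sig f a <= proj1_sig fa a /\
                                proj1_sig f b <= proj1_sig fb b).
      { destruct (Ctot _ _ Ca Cb) as [H|H]; apply boolp.asboolW in H;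
          [exists fb | exists fa]; split; auto; lra. }
      destruct H as ([f [Hf Hf']] & H1 & H2); simpl in H1, H2.
      specialize (Hf a b); lra.
    - intros i a; apply (@Rinf_is_glb (V a) 0); [apply VN | apply V0 |].
      intros t ([f [Hf Hf']] & _ & ->); apply Hf'. }
  exists (exist _ m Hm); intros f Cf; apply boolp.asboolT; intros a; simpl.
  apply (@Rinf_is_glb (V a) 0); eauto; exists f; auto.
- exists f; split; [exact Hf |]; intros g Hg Hgf a.
  assert (H : is_true (boolp.asbool (le (exist _ g Hg) (exist _ f Hf))))
    by (apply Hmin, boolp.asboolT; exact Hgf).
  apply boolp.asboolW in H; exact (H a).
Qed.

Section Minimal.

Variable f : T -> R.
Hypothesis Hf : admissible f.
Hypothesis Hmin :
  forall g, admissible g -> (forall a, g a <= f a) -> forall a, f a <= g a.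

Let C (z : T) : Prop := forall a, d a z <= f a.

(* By minimality, [f a] is at most the sup of [d a k] over [K], since this sup is an
   admissible function of [a] lying below [f]. *)
Lemma minimal_le (K : T -> Prop) (a : T) (t : R) :
  (forall k, K k -> C k) -> (forall i, exists k, K k /\ E i k) ->
  (forall k, K k -> d a k <= t) -> f a <= t.
Proof.
intros KC KE Kt.
(* The supremum of [d b k] over [K] is expressed as the infimum of its upper bounds. *)
pose (U b r := forall k, K k -> d b k <= r).
assert (UN : forall b, exists r, U b r) by
  (intros b; exists (f b); intros k Kk; exact (KC k Kk b)).
destruct (KE i0) as (k0 & Kk0 & _).
assert (U0 : forall b r, U b r -> 0 <= r)
  by (intros b r Hr; specialize (Hr k0 Kk0); specialize (d0 b k0); lra).
assert (Hk : forall b k, K k -> d b k <= Rinf (U b))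
  by (intros b k Kk; apply (@Rinf_is_glb (U b) 0); eauto; intros r Hr; exact (Hr k Kk)).
apply Rle_trans with (Rinf (U a)); [| apply (@Rinf_is_glb (U a) 0); eauto].
apply (@Hmin (fun b => Rinf (U b))).
- split.
  + intros b b'; assert (H := dtri b k0 b'); rewrite (dC k0 b') in H.
    assert (H1 := Hk b k0 Kk0); assert (H2 := Hk b' k0 Kk0); lra.
  + intros i b; destruct (KE i) as (k & Kk & Ek).
    apply Rle_trans with (2 := Hk b k Kk); apply dist_set_le; auto.
- intros b; apply (@Rinf_is_glb (U b) 0); eauto; intros k Kk; exact (KC k Kk b).
Qed.

(** The two-set intersection is applied to all balls B(a, f a), indexed by [T] itself. *)
Lemma minimal_meet (i j : I) : exists c, C c /\ E i c /\ E j c.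
Proof.
destruct (@ext_hyperconvex_inter (E i) (E j) (@HE i) (@HE j) (@Hnear i j) T (fun a => a) f)
  as (z & Ei & Ej & Hz); try apply Hf.
exists z; auto.
Qed.

(** By [minimal_meet], the part of [C] in a single [E i] meets every [E j], so it can serve as
    [K]. *)
Lemma minimal_le_slice (i : I) (a : T) (t : R) :
  (forall c, C c -> E i c -> d a c <= t) -> f a <= t.
Proof.
intros H; apply (@minimal_le (fun c => C c /\ E i c)); try tauto; [| firstorder].
intros j; destruct (minimal_meet i j) as (c & Cc & Ei & Ej); exists c; auto.
Qed.

(* The part of [C] in each [E i] contains a point within [delta / 2] of all of that
   part; these Chebyshev centres may serve as [K] in [minimal_le]. *)
Lemma minimal_halve (delta : R) :
  (forall c, C c -> f c <= delta) -> forall c, C c -> f c <= delta / 2.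
Proof.
intros Hdelta.
assert (centre : forall i, exists z, C z /\ E i z /\ f z <= delta / 2).
{ intros i.
  (* The balls B(a, f a) force the new point into [C]. The balls of radius [delta / 2] about the
     slice are compatible because two points [c], [c'] of [C] satisfy [d c c' <= f c <= delta]. *)
  pose (J := (T + {c | C c /\ E i c})%type).
  destruct (@HE i J (fun o => match o with inl a => a | inr c => proj1_sig c end)
    (fun o => match o with inl a => f a | inr _ => delta / 2 end)) as (z & Ez & Hz).
  - assert (H : forall a (c : {c | C c /\ E i c}), d a (proj1_sig c) <= f a + delta / 2).
    { intros a [c [Cc Ec]]; simpl; specialize (Cc a) as H1; specialize (Hdelta c Cc).
      assert (H2 := admissible_ge0 c Hf); lra. }
    intros [a|c] [a'|c'].
    + apply Hf.
    + apply H.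
    + rewrite dC, Rplus_comm; apply H.
    + destruct c as [c [Cc Ec]], c' as [c' [Cc' Ec']]; simpl.
      specialize (Cc' c); specialize (Hdelta c Cc); lra.
  - intros [a|[c [Cc Ec]]]; simpl; [apply Hf |].
    apply Rle_trans with (d c c); [apply dist_set_le; auto |].
    rewrite dxx; specialize (Hdelta c Cc); assert (H2 := admissible_ge0 c Hf); lra.
  - exists z; split; [intros a; exact (Hz (inl a)) |]; split; [exact Ez |].
    apply minimal_le_slice with i; intros c Cc Ec; rewrite dC.
    exact (Hz (inr (exist _ c (conj Cc Ec)))). }
intros c Cc.
apply (@minimal_le (fun z => C z /\ f z <= delta / 2)).
- tauto.
- intros i; destruct (centre i) as (z & ? & ? & ?); exists z; auto.
- intros z [_ Hz]; rewrite dC; specialize (Cc z); lra.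
Qed.

(** Points of [C] are within [f c0] of [c0], hence within [2 * f c0] of each other, which bounds [f]
    on [C]; this bound is then halved indefinitely. *)
Lemma minimal_zero (c : T) : C c -> f c = 0.
Proof.
destruct (minimal_meet i0 i0) as (c0 & Cc0 & _ & _).
assert (H : forall n c, C c -> f c <= 2 * f c0 * (1 / 2) ^ n).
{ induction n as [| n IH].
  - intros c1 Cc1; simpl; rewrite Rmult_1_r.
    apply minimal_le_slice with i0; intros k Ck _.
    assert (H := dtri c1 c0 k); specialize (Ck c0); specialize (Cc1 c0).
    rewrite (dC c1 c0) in H; lra.
  - intros c1 Cc1.
    replace (2 * f c0 * (1 / 2) ^ S n) with (2 * f c0 * (1 / 2) ^ n / 2)
      by (simpl; field).
    apply minimal_halve; assumption. }
intros Cc; apply Rle_antisym; [| apply admissible_ge0; exact Hf].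
apply le0_of_le_pow_half with (C := 2 * f c0); auto.
Qed.

End Minimal.

(** As [f] vanishes on [C], the set [C] is a single point, and [C] meets every [E i]. *)
Theorem ext_hyperconvex_helly : exists z, forall i, E i z.
Proof.
destruct admissible_minimal as (f & Hf & Hmin).
destruct (minimal_meet Hf i0 i0) as (c & Cc & _ & _).
exists c; intros i.
destruct (minimal_meet Hf i i) as (z & Cz & Ez & _).
replace c with z; [exact Ez |].
apply Hd; apply Rle_antisym; [| apply d0].
rewrite <- (minimal_zero Hf Hmin Cz); apply Cc.
Qed.

End Helly.

End Metric.

(** * The gluing metric *)

Section Gluing.

Variables (L : Type) (X : L -> Type) (d : forall l, X l -> X l -> R).
Variables (A : Type) (dA : A -> A -> R) (phi : forall l, A -> X l).
Hypothesis HdA : is_metric dA.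
Hypothesis Hd : forall l, is_metric (@d l).
Hypothesis Hiso : forall l a b, d (phi l a) (phi l b) = dA a b.

Notation glued := (glue_dist d phi).

Let d0 l (x y : X l) : 0 <= d x y. Proof. apply Hd. Qed.
Let dxx l (x : X l) : d x x = 0. Proof. apply Hd; reflexivity. Qed.
Let dC l (x y : X l) : d x y = d y x. Proof. apply Hd. Qed.
Let dtri l (x y z : X l) : d x z <= d x y + d y z. Proof. apply Hd. Qed.
Let dA0 x y : 0 <= dA x y. Proof. apply HdA. Qed.
Let dAxx x : dA x x = 0. Proof. apply HdA; reflexivity. Qed.

Let dist_to (p : {l : L & X l}) (a : A) : R := d (projT2 p) (phi (projT1 p) a).

Lemma glue_dist_same (l : L) (x y : X l) : glued (existT X l x) (existT X l y) = d x y.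
Proof.
unfold glue_dist; simpl.
destruct (excluded_middle_informative (l = l)) as [e | n]; [| congruence].
rewrite (proof_irrelevance _ e eq_refl); reflexivity.
Qed.

Section Distinct.

Variables p q : {l : L & X l}.
Hypothesis Hpq : projT1 p <> projT1 q.

Let S s := exists a : A, s = dist_to p a + d (phi (projT1 q) a) (projT2 q).

Lemma glue_dist_distinct : glued p q = Rinf S.
Proof.
unfold glue_dist.
destruct (excluded_middle_informative (projT1 p = projT1 q)); [contradiction | reflexivity].
Qed.

Let S0 s : S s -> 0 <= s.
Proof. intros [a ->]; apply Rplus_le_le_0_compat; apply d0. Qed.

Lemma glue_dist_approx (eta : R) :
  inhabited A -> 0 < eta -> exists a, dist_to p a + dist_to q a < glued p q + eta.
Proof.
intros [a0] Heta.
destruct (@Rinf_approx S 0 (glued p q + eta)) as (s & [a ->] & Hs).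
- exists (dist_to p a0 + d (phi (projT1 q) a0) (projT2 q)), a0; reflexivity.
- exact S0.
- rewrite glue_dist_distinct; lra.
- exists a; unfold dist_to at 2; rewrite (dC (projT2 q)); exact Hs.
Qed.

End Distinct.

Lemma glue_dist_le (p q : {l : L & X l}) (a : A) : glued p q <= dist_to p a + dist_to q a.
Proof.
destruct (classic (projT1 p = projT1 q)) as [e | n].
- destruct p as [l x], q as [l' y]; simpl in e; subst l'.
  rewrite glue_dist_same; unfold dist_to; simpl.
  rewrite (dC y); apply dtri.
- rewrite (glue_dist_distinct n).
  set (S := fun s => _).
  assert (Sa : S (dist_to p a + dist_to q a))
    by (exists a; unfold dist_to; rewrite (dC (projT2 q)); reflexivity).
  apply (@Rinf_is_glb S 0); eauto.
  intros s [b ->]; apply Rplus_le_le_0_compat; apply d0.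
Qed.

Lemma glue_dist_ge0 (p q : {l : L & X l}) : inhabited A -> 0 <= glued p q.
Proof.
intros HA; destruct (classic (projT1 p = projT1 q)) as [e | n].
- destruct p as [l x], q as [l' y]; simpl in e; subst l'.
  rewrite glue_dist_same; apply d0.
- apply le_epsilon; intros eta Heta.
  destruct (glue_dist_approx n HA Heta) as [a Ha].
  assert (H := d0 (projT2 p) (phi _ a)); assert (H' := d0 (projT2 q) (phi _ a)).
  unfold dist_to in Ha; lra.
Qed.

Lemma glue_dist_refl (p : {l : L & X l}) : glued p p = 0.
Proof. destruct p as [l x]; rewrite glue_dist_same; apply dxx. Qed.

(** A detour through [b] in [A] cannot be shorter: the isometries carry its second leg back into the
    piece of [p], where the triangle inequality applies. So the distance to a point of [A] does not
    depend on the chosen copy. *)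
Lemma glue_dist_phi (p : {l : L & X l}) (l : L) (a : A) :
  glued p (existT X l (phi l a)) = dist_to p a.
Proof.
apply Rle_antisym.
- apply Rle_trans with (1 := glue_dist_le p _ a).
  unfold dist_to at 2; simpl; rewrite dxx; lra.
- destruct (classic (projT1 p = l)) as [e | n].
  + destruct p as [l' x]; simpl in e; subst l'; rewrite glue_dist_same; apply Rle_refl.
  + apply le_epsilon; intros eta Heta.
    destruct (@glue_dist_approx p (existT X l (phi l a)) n eta) as [b Hb];
      [exact (inhabits a) | exact Heta |].
    unfold dist_to in *; simpl in Hb; rewrite Hiso in Hb.
    assert (H := dtri (projT2 p) (phi _ b) (phi _ a)); rewrite Hiso in H.
    assert (HC : dA a b = dA b a) by apply HdA; lra.
Qed.

Lemma glue_dist_C (p q : {l : L & X l}) : inhabited A -> glued p q = glued q p.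
Proof.
intros HA.
assert (H : forall p q, glued p q <= glued q p).
{ clear p q; intros p q; destruct (classic (projT1 p = projT1 q)) as [e | n].
  - destruct p as [l x], q as [l' y]; simpl in e; subst l'.
    rewrite !glue_dist_same, dC; apply Rle_refl.
  - apply le_epsilon; intros eta Heta.
    destruct (@glue_dist_approx q p (not_eq_sym n) eta HA Heta) as [a Ha].
    assert (H := glue_dist_le p q a); lra. }
apply Rle_antisym; apply H.
Qed.

Lemma glued_A_dist_leP (p : {l : L & X l}) (r : R) : inhabited A ->
  (dist_set glued (glued_A phi) p <= r <->
   forall eta, 0 < eta -> exists a, dist_to p a <= r + eta).
Proof.
intros HA; rewrite dist_set_leP.
- split; intros H eta Heta.
  + destruct (H eta Heta) as (y & [a ->] & Hy).
    exists a; rewrite <- (glue_dist_phi p (projT1 y)); exact Hy.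
  + destruct (H eta Heta) as [a Ha].
    exists (existT X (projT1 p) (phi _ a)); split; [exists a; reflexivity |].
    rewrite glue_dist_phi; exact Ha.
- intros x y; apply glue_dist_ge0; exact HA.
- destruct HA as [a0]; exists (existT X (projT1 p) (phi _ a0)), a0; reflexivity.
Qed.

(** * Traces of balls on [A], and external hyperconvexity of [A] in the gluing *)

Hypothesis Hext : forall l, ext_hyperconvex (@d l) (image (phi l)).

(** The right-hand side is that of [glued_A_dist_leP]: the distance to [A] is the same in the piece
    and in the gluing. *)
Lemma image_dist_leP (p : {l : L & X l}) (r : R) : inhabited A ->
  (dist_set (@d (projT1 p)) (image (phi (projT1 p))) (projT2 p) <= r <->
   forall eta, 0 < eta -> exists a, dist_to p a <= r + eta).
Proof.
intros [a0]; rewrite dist_set_leP.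
- split; intros H eta Heta.
  + destruct (H eta Heta) as (y & [a ->] & Hy); exists a; exact Hy.
  + destruct (H eta Heta) as [a Ha]; exists (phi _ a).
    split; [exists a; reflexivity | exact Ha].
- apply d0.
- exists (phi _ a0), a0; reflexivity.
Qed.

Lemma image_ext_hyperconvex (l : L) (J : Type) (x : J -> X l) (r : J -> R) :
  inhabited A ->
  (forall i j, d (x i) (x j) <= r i + r j) ->
  (forall i eta, 0 < eta -> exists a, d (x i) (phi l a) <= r i + eta) ->
  exists a, forall i, d (x i) (phi l a) <= r i.
Proof.
intros HA Hx Hr.
destruct (@Hext l J x r Hx) as (z & [a ->] & Hz).
- intros i; apply (image_dist_leP (existT X l (x i))); [exact HA | apply Hr].
- exists a; exact Hz.
Qed.

(** The ball about [p] is added to the given balls centred on [A], inside the piece of [p]. It is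
    compatible with them because each centre [c j] is within [s j], up to [eta], of a point of the
    trace. *)
Lemma ball_trace_ext_hyperconvex (p : {l : L & X l}) (r : R) :
  inhabited A -> 0 <= r ->
  (forall eta, 0 < eta -> exists a, dist_to p a <= r + eta) ->
  ext_hyperconvex dA (fun a => dist_to p a <= r).
Proof.
destruct p as [l x]; intros HA r0 Hr.
assert (ne : exists a, dist_to (existT X l x) a <= r).
{ destruct (@image_ext_hyperconvex l unit (fun _ => x) (fun _ => r)) as [a Ha]; auto.
  - intros _ _; rewrite dxx; lra.
  - exists a; exact (Ha tt). }
intros J c s Hc Hs.
destruct (@image_ext_hyperconvex l (option J)
  (fun o => match o with Some j => phi l (c j) | None => x end)
  (fun o => match o with Some j => s j | None => r end)) as [a Ha]; auto.
- assert (H : forall j, d x (phi l (c j)) <= r + s j).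
  { intros j; apply le_epsilon; intros eta Heta.
    destruct (proj1 (dist_set_leP (c j) (s j) dA0 ne) (Hs j) eta Heta) as (b & Hb & Hjb).
    unfold dist_to in Hb; simpl in Hb.
    assert (H := dtri x (phi l b) (phi l (c j))); rewrite (dC (phi l b)), Hiso in H; lra. }
  intros [i|] [j|].
  + rewrite Hiso; auto.
  + rewrite dC, Rplus_comm; auto.
  + auto.
  + rewrite dxx; lra.
- intros [j|] eta Heta; [| auto].
  exists (c j); rewrite dxx.
  specialize (Hc j j); rewrite dAxx in Hc; lra.
- exists a; split; [exact (Ha None) |].
  intros j; unfold ball; rewrite <- (Hiso l); exact (Ha (Some j)).
Qed.

(** External hyperconvexity of [A] in the piece of [p] is applied to just two balls, about [p] and
    about [a]. *)
Lemma ball_trace_near (p : {l : L & X l}) (r t : R) (a : A) :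
  0 <= r -> 0 <= t ->
  (forall eta, 0 < eta -> exists a, dist_to p a <= r + eta) ->
  dist_to p a <= r + t ->
  exists b, dist_to p b <= r /\ dA a b <= t.
Proof.
destruct p as [l x]; unfold dist_to; simpl; intros r0 t0 Hr Ha.
destruct (@image_ext_hyperconvex l bool (fun o => if o then x else phi l a)
  (fun o => if o then r else t)) as [b Hb].
- exact (inhabits a).
- intros [|] [|]; rewrite ?dxx; try lra; rewrite dC; lra.
- intros [|] eta Heta; [auto |].
  exists a; rewrite dxx; lra.
- exists b; split; [exact (Hb true) |].
  rewrite <- (Hiso l); exact (Hb false).
Qed.

(** The Helly theorem is applied to the traces of the balls on [A]; it remains to see that they are
    pairwise at distance zero and that one of them is bounded. *)
Lemma glued_ext_hyperconvex (I : Type) (x : I -> {l : L & X l}) (r : I -> R) :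
  inhabited A ->
  (forall i j, glued (x i) (x j) <= r i + r j) ->
  (forall i, dist_set glued (glued_A phi) (x i) <= r i) ->
  exists a, forall i, dist_to (x i) a <= r i.
Proof.
intros HA Hx Hr.
assert (Hr' : forall i eta, 0 < eta -> exists a, dist_to (x i) a <= r i + eta)
  by (intros i; apply glued_A_dist_leP; auto).
assert (r0 : forall i, 0 <= r i)
  by (intros i; specialize (Hx i i); rewrite glue_dist_refl in Hx; lra).
assert (HE : forall i, ext_hyperconvex dA (fun a => dist_to (x i) a <= r i))
  by (intros i; apply ball_trace_ext_hyperconvex; auto).
destruct (classic (inhabited I)) as [[i0] | Iempty].
2: { destruct HA as [a]; exists a; intros i; exfalso; apply Iempty; exact (inhabits i). }
destruct (ext_hyperconvex_nonempty (HE i0)) as [w Hw].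
apply (@ext_hyperconvex_helly A dA HdA I (fun i a => dist_to (x i) a <= r i) i0 w
  (r i0 + r i0)); [exact HE | |].
- intros i j eps Heps.
  destruct (classic (projT1 (x i) = projT1 (x j))) as [e | n].
  (* Within one piece the two traces even share a point. *)
  + specialize (Hx i j); assert (Hi := Hr' i); assert (Hj := Hr' j).
    assert (ri := r0 i); assert (rj := r0 j).
    destruct (x i) as [l y], (x j) as [l' y']; simpl in e; subst l'.
    rewrite glue_dist_same in Hx; unfold dist_to in *; simpl in *.
    destruct (@image_ext_hyperconvex l bool (fun b => if b then y else y')
      (fun b => if b then r i else r j)) as [a Ha]; auto.
    * intros [|] [|]; try (rewrite dxx; lra); [lra | rewrite dC; lra].
    * intros [|]; auto.
    * exists a, a; split; [exact (Ha true) |]; split; [exact (Ha false) |].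
      rewrite dAxx; lra.
  (* The distances to [a] add up to less than [r i + r j + eps]. If [a] lies outside a trace, moving
     it there costs its excess over that radius, after which the other trace is within [eps]. *)
  + destruct (glue_dist_approx n HA Heps) as [a Ha]; specialize (Hx i j).
    assert (Htri : forall k b, dist_to (x k) b <= dist_to (x k) a + dA a b)
      by (intros k b; rewrite <- (Hiso (projT1 (x k))); apply dtri).
    destruct (Rle_lt_dec (dist_to (x j) a) (r j)) as [Hj | Hj];
      [destruct (Rle_lt_dec (dist_to (x i) a) (r i)) as [Hi | Hi] |].
    * exists a, a; rewrite dAxx; split; [exact Hi |]; split; [exact Hj | lra].
    * destruct (@ball_trace_near (x i) (r i) (dist_to (x i) a - r i) a) as (p & Hp & Hap);
        auto; try lra.
      destruct (@ball_trace_near (x j) (r j) eps p) as (q & Hq & Hpq); auto; try lra.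
      { specialize (Htri j p); lra. }
      exists p, q; auto.
    * destruct (@ball_trace_near (x j) (r j) (dist_to (x j) a - r j) a) as (q & Hq & Haq);
        auto; try lra.
      destruct (@ball_trace_near (x i) (r i) eps q) as (p & Hp & Hqp); auto; try lra.
      { specialize (Htri i q); lra. }
      exists p, q; split; [exact Hp |]; split; [exact Hq |].
      replace (dA p q) with (dA q p) by apply HdA; exact Hqp.
- intros p Hp; rewrite <- (Hiso (projT1 (x i0))).
  assert (H := dtri (phi _ w) (projT2 (x i0)) (phi _ p)).
  rewrite (dC (phi _ w) (projT2 (x i0))) in H; unfold dist_to in Hw, Hp.
  cbv beta in Hw, Hp; lra.
Qed.

(** * Hyperconvexity of the gluing *)

Hypothesis Hhyp : forall l, hyperconvex (@d l).

(* When the ball around [x i0] misses A, let [s > 0] be the largest excess of the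
   distance to A over the radius among the centres in the piece X_l of [x i0].
   Enlarging the radii in X_l by [s] yields a point [p] of A in all balls; shrinking
   by [s] the other balls and adding B(p, s) yields points of A that are pairwise at
   distance at most [2 s], and whose [s]-balls can stand in for the balls with
   centres outside X_l. *)
Lemma glued_hyperconvex (I : Type) (x : I -> {l : L & X l}) (r : I -> R) :
  inhabited L -> inhabited A ->
  (forall i j, glued (x i) (x j) <= r i + r j) ->
  exists z, forall i, glued (x i) z <= r i.
Proof.
intros [l0] HA Hx.
pose (D i := dist_set glued (glued_A phi) (x i)).
assert (HD : forall i eta, 0 < eta -> exists a, dist_to (x i) a <= D i + eta)
  by (intros i; apply glued_A_dist_leP; [exact HA | apply Rle_refl]).
assert (Dle : forall i a, D i <= dist_to (x i) a).
{ intros i a; apply glued_A_dist_leP; [exact HA |].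
  intros eta Heta; exists a; lra. }
assert (Dlip : forall i j, projT1 (x i) = projT1 (x j) ->
  D i <= glued (x i) (x j) + D j).
{ intros i j e; apply le_epsilon; intros eta Heta.
  destruct (HD j eta Heta) as [a Ha]; apply Rle_trans with (1 := Dle i a).
  destruct (x i) as [l y], (x j) as [l' y']; simpl in e; subst l'.
  rewrite glue_dist_same; unfold dist_to in *; simpl in *.
  assert (H := dtri y y' (phi l a)); lra. }
assert (Dsum : forall i j, projT1 (x i) <> projT1 (x j) -> D i + D j <= r i + r j).
{ intros i j n; apply le_epsilon; intros eta Heta.
  destruct (glue_dist_approx n HA Heta) as [a Ha].
  specialize (Hx i j); assert (Hi := Dle i a); assert (Hj := Dle j a); lra. }
destruct (classic (forall i, D i <= r i)) as [Hr | Hr].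
{ destruct (glued_ext_hyperconvex HA Hx Hr) as [a Ha].
  exists (existT X l0 (phi l0 a)); intros i; rewrite glue_dist_phi; apply Ha. }
apply not_all_ex_not in Hr; destruct Hr as [i0 Hi0]; apply Rnot_le_lt in Hi0.
pose (l := projT1 (x i0)).
(* [V] collects the upper bounds of the excesses, so its infimum [s] is their supremum, attained or
   not. *)
pose (V s := forall i, projT1 (x i) = l -> D i - r i <= s).
assert (VN : exists s, V s).
{ exists (r i0 + D i0); intros i Hi.
  assert (H := Dlip i i0 Hi); specialize (Hx i i0); lra. }
assert (V0 : forall s, V s -> D i0 - r i0 <= s) by (intros s Vs; apply Vs; reflexivity).
destruct (Rinf_is_glb VN V0) as [Vlow Vglb]; set (s := Rinf V) in *.
assert (s0 : 0 < s) by (specialize (Vglb _ V0); lra).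
assert (Hin : forall i, projT1 (x i) = l -> D i <= r i + s).
{ intros i Hi; assert (D i - r i <= s); [| lra].
  apply Vglb; intros t Vt; apply Vt; exact Hi. }
(* By [Dsum], [r j - D j] bounds every excess in X_l, hence is at least [s]. *)
assert (Hout : forall j, projT1 (x j) <> l -> D j <= r j - s).
{ intros j Hj; assert (s <= r j - D j); [| lra].
  apply Vlow; intros i Hi.
  assert (H := Dsum i j ltac:(congruence)); lra. }
assert (Hp : exists a, forall i, dist_to (x i) a <=
  if excluded_middle_informative (projT1 (x i) = l) then r i + s else r i).
{ apply glued_ext_hyperconvex; [exact HA | |].
  - intros i j; specialize (Hx i j).
    destruct (excluded_middle_informative (projT1 (x i) = l)),
      (excluded_middle_informative (projT1 (x j) = l)); lra.
  - intros i; destruct (excluded_middle_informative (projT1 (x i) = l)) as [e | n].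
    + exact (Hin i e).
    + specialize (Hout i n); unfold D in Hout; lra. }
destruct Hp as [p Hp].
assert (Hpin : forall i, projT1 (x i) = l -> dist_to (x i) p <= r i + s).
{ intros i Hi; specialize (Hp i).
  destruct (excluded_middle_informative (projT1 (x i) = l)); [exact Hp | contradiction]. }
assert (Hpout : forall j, projT1 (x j) <> l -> dist_to (x j) p <= r j).
{ intros j Hj; specialize (Hp j).
  destruct (excluded_middle_informative (projT1 (x j) = l)); [contradiction | exact Hp]. }
(* The implication sits under the existential so that choice gives a function on all of [I], with
   [p] as default for centres in X_l. *)
assert (Hq : forall j, exists q, projT1 (x j) <> l ->
  dist_to (x j) q <= r j - s /\ dA p q <= s /\
  forall i, projT1 (x i) = l -> dist_to (x i) q <= r i + s).
{ intros j; destruct (classic (projT1 (x j) = l)) as [e | n]; [exists p; contradiction |].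
  (* Radii [r i + s] and [r j - s] keep the sum [r i + r j]; the ball of radius [s] about [p] is
     compatible because [p] is within [r i + s] of [x i] and within [r j] of [x j]. *)
  pose (J := ({i | projT1 (x i) = l} + bool)%type).
  pose (y (o : J) := match o with
    | inl i => x (proj1_sig i)
    | inr true => x j
    | inr false => existT X l (phi l p)
    end).
  pose (t (o : J) := match o with
    | inl i => r (proj1_sig i) + s
    | inr true => r j - s
    | inr false => s
    end).
  assert (Hpp : forall q, dist_to (existT X l (phi l p)) q = dA p q)
    by (intros q; unfold dist_to; simpl; apply Hiso).
  destruct (@glued_ext_hyperconvex J y t) as [q Hq]; [exact HA | | |].
  - intros [[i Hi]|[|]] [[i' Hi']|[|]]; simpl.
    + specialize (Hx i i'); lra.
    + specialize (Hx i j); lra.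
    + rewrite glue_dist_phi; specialize (Hpin i Hi); lra.
    + specialize (Hx j i'); lra.
    + specialize (Hout j n); rewrite glue_dist_refl.
      assert (H : 0 <= D j); [| lra].
      apply le_epsilon; intros eta Heta; destruct (HD j eta Heta) as [a Ha].
      assert (H := d0 (projT2 (x j)) (phi _ a)); unfold dist_to in Ha; lra.
    + rewrite glue_dist_phi; specialize (Hpout j n); lra.
    + rewrite glue_dist_C by exact HA.
      rewrite glue_dist_phi; specialize (Hpin i' Hi'); lra.
    + rewrite glue_dist_C by exact HA.
      rewrite glue_dist_phi; specialize (Hpout j n); lra.
    + rewrite glue_dist_refl; lra.
  - intros [[i Hi]|[|]]; simpl; [apply Hin; exact Hi | apply Hout; exact n |].
    apply glued_A_dist_leP; [exact HA |]; intros eta Heta; exists p.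
    rewrite Hpp, dAxx; lra.
  - exists q; intros _; split; [exact (Hq (inr true)) |]; split.
    + rewrite <- Hpp; exact (Hq (inr false)).
    + intros i Hi; exact (Hq (inl (exist _ i Hi))). }
destruct (boolp.choice Hq) as [q Hq'].
(* Only centres in X_l remain, with their original radii, so hyperconvexity of that piece
   applies. *)
pose (J := ({i | projT1 (x i) = l} + {j | projT1 (x j) <> l})%type).
pose (y (o : J) := match o with
  | inl i => eq_rect _ X (projT2 (x (proj1_sig i))) l (proj2_sig i)
  | inr j => phi l (q (proj1_sig j))
  end).
pose (t (o : J) := match o with inl i => r (proj1_sig i) | inr _ => s end).
assert (Hy : forall i e, existT X l (eq_rect _ X (projT2 (x i)) l e) = x i).
{ intros i e; destruct (x i) as [l' z]; simpl in *; subst l'; reflexivity. }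
destruct (@Hhyp l J y t) as [z Hz].
- assert (Hxq : forall i (e : projT1 (x i) = l) j, projT1 (x j) <> l ->
    d (eq_rect _ X (projT2 (x i)) l e) (phi l (q j)) <= r i + s).
  { intros i e j n; destruct (Hq' j n) as (_ & _ & H); specialize (H i e).
    rewrite <- (Hy i e) in H; exact H. }
  intros [[i e]|[j n]] [[i' e']|[j' n']]; simpl.
  + rewrite <- glue_dist_same, !Hy; apply Hx.
  + apply Hxq; exact n'.
  + rewrite dC, Rplus_comm; apply Hxq; exact n.
  + rewrite Hiso.
    destruct (Hq' j n) as (_ & H1 & _), (Hq' j' n') as (_ & H2 & _).
    destruct HdA as (_ & _ & HC & Htri).
    assert (H := Htri (q j) p (q j')); rewrite (HC (q j) p) in H; lra.
- exists (existT X l z); intros i.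
  destruct (classic (projT1 (x i) = l)) as [e | n].
  + rewrite <- (Hy i e), glue_dist_same; exact (Hz (inl (exist _ i e))).
  (* Passing through [q i] costs at most [(r i - s) + s]. *)
  + apply Rle_trans with (1 := glue_dist_le _ _ (q i)).
    destruct (Hq' i n) as (H & _ & _).
    assert (H1 := Hz (inr (exist _ i n))); unfold ball in H1; simpl in H1.
    unfold dist_to at 2; simpl; rewrite dC; lra.
Qed.

End Gluing.

Unset Implicit Arguments.

Theorem theorem1p3
  (L : Type) (X : L -> Type) (d : forall l, X l -> X l -> R)
  (A : Type) (dA : A -> A -> R) (phi : forall l, A -> X l)
  (HL : inhabited L)
  (HdA : is_metric dA)
  (Hd : forall l, is_metric (d l))
  (Hiso : forall l a b, d l (phi l a) (phi l b) = dA a b)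
  (Hclosed : forall l, is_closed (d l) (image (phi l)))
  (Hhyp : forall l, hyperconvex (d l))
  (Hext : forall l, ext_hyperconvex (d l) (image (phi l))) :
  hyperconvex (glue_dist d phi) /\ ext_hyperconvex (glue_dist d phi) (glued_A phi).
Proof.
destruct HL as [l].
(* A point of [A] makes the infima in the gluing metric range over nonempty sets. *)
destruct (ext_hyperconvex_nonempty (Hext l)) as (_ & a & _).
assert (HA : inhabited A) by exact (inhabits a).
split.
- intros I x r Hx.
  exact (glued_hyperconvex HdA Hd Hiso Hext Hhyp (inhabits l) HA Hx).
- intros I x r Hx Hr.
  destruct (glued_ext_hyperconvex HdA Hd Hiso Hext HA Hx Hr) as [b Hb].
  exists (existT X l (phi l b)); split; [exists b; reflexivity |].
  intros i; unfold ball; rewrite (glue_dist_phi HdA Hd Hiso); apply Hb.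
Qed.
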